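(* Let $X_1,\dots,X_n$ be independent mean-zero real random variables with $\|X_i\|_{\Psi_\alpha}<\infty$ for some $\alpha\ge1$, let $\beta$ satisfy $\frac1\alpha+\frac1\beta=1$, let $a_1,\dots,a_n$ be any $n$ real scalars, and let $p\ge1$. Then for all $\alpha\ge1$, $$\mathbb E\left\{\left|\sum_{i=1}^n a_iX_i\right|^p\right\}\le C_1^pp^{\frac p2}\left(\sum_{i=1}^n a_i^2\|X_i\|_{\Psi_\alpha}^2\right)^{\frac p2}+C_1^pp^{\frac p\alpha}\left(\sum_{i=1}^n|a_i|^\beta\|X_i\|_{\Psi_\alpha}^\beta\right)^{\frac p\beta}\exp\left(-C\left(\frac{\left(\sum_{i=1}^n|a_i|^\beta\|X_i\|_{\Psi_\alpha}^\beta\right)^{\frac1\beta}}{\left(\sum_{i=1}^n a_i^2\|X_i\|_{\Psi_\alpha}^2\right)^{\frac12}}\right)^{\frac{2\alpha}{\alpha-2}}\right),$$ and additionally, for all $\alpha\ge2$, $$\mathbb E\left\{\left|\sum_{i=1}^n a_iX_i\right|^p\right\}\le C_2^p\min\left\{p^{\frac p2}\left(\sum_{i=1}^n a_i^2\|X_i\|_{\Psi_\alpha}^2\right)^{\frac p2},\ p^{\frac p\alpha}\left(\sum_{i=1}^n|a_i|^\beta\|X_i\|_{\Psi_\alpha}^\beta\right)^{\frac p\beta}\right\},$$ where the constants $C,C_1,C_2>0$ do not depend on $\alpha$, $p$, and $\{X_i\}_{i=1}^n$.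
   Context: For a real random variable $X$ and $\alpha\ge1$, the Orlicz norm is $\|X\|_{\Psi_\alpha}:=\inf\{u>0:\ \mathbb E\exp((|X|/u)^\alpha)\le 2\}$. When $\alpha=1$, $\beta=\infty$ and $(\sum_{i=1}^n|a_i|^\beta\|X_i\|_{\Psi_1}^\beta)^{1/\beta}$ means $\max_{i=1,\dots,n}|a_i|\|X_i\|_{\Psi_1}$. *)

(* Defs.v *)
From HB Require Import structures.
From mathcomp Require Import all_boot all_order all_algebra.
From mathcomp Require Import all_classical all_reals all_analysis.

Set Implicit Arguments.
Unset Strict Implicit.
Unset Printing Implicit Defensive.

Import Order.TTheory GRing.Theory Num.Theory.
Import numFieldNormedType.Exports.

Local Open Scope classical_set_scope.
Local Open Scope ring_scope.

(* An infimum in [\bar R]: it is [+oo] when no [u] qualifies. *)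
Definition orlicz_norm (d : measure_display) (T : measurableType d)
    (R : realType) (P : probability T R) (alpha : R) (X : T -> R) : \bar R :=
  ereal_inf [set u%:E | u in
    [set u : R | 0 < u /\
      ('E_P[fun w => (expR ((`|X w| / u) `^ alpha))%R] <= 2%:E)%E]].

Definition mutually_independent (d : measure_display) (T : measurableType d)
    (R : realType) (P : probability T R) (I : finType)
    (X : I -> {RV P >-> R}) : Prop :=
  forall (J : {set I}) (B : I -> set R),
    (forall i, i \in J -> measurable (B i)) ->
    P (\bigcap_(i in [set` J]) (X i @^-1` B i)) =
    (\prod_(i in J) P (X i @^-1` B i))%E.

(* (\sum_i |a_i|^beta s_i^beta)^(1/beta) for [s >= 0], read as
   max_i |a_i| s_i when [beta = +oo]; the value at [-oo] is junk. *)
Definition weighted_norm (R : realType) (n : nat) (beta : \bar R)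
    (a s : 'I_n -> R) : R :=
  match beta with
  | b%:E => (\sum_(i < n) `|a i| `^ b * s i `^ b) `^ b^-1
  | +oo%E => \big[Num.max/0]_(i < n) (`|a i| * s i)
  | -oo%E => 0
  end.

(* Main.v *)
Require Import Defs.
From mathcomp Require Import all_boot all_order all_algebra.
From mathcomp Require Import all_classical all_reals all_analysis.
From mathcomp Require Import measurable_realfun ring lra.

Set Implicit Arguments.
Unset Strict Implicit.
Unset Printing Implicit Defensive.

Import Order.TTheory GRing.Theory Num.Theory.
Import numFieldNormedType.Exports.

Local Open Scope classical_set_scope.
Local Open Scope ring_scope.

(** The sum Z = sum_i a_i X_i is controlled through its moment generating
    function rather than through its tails.  For l > 0 and p >= 1,

      |z|^p <= (p/l)^p exp(l|z|) <= (p/l)^p (exp(l z) + exp(- l z)),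

    so E|Z|^p is at most (p/l)^p times the sum of the values at l and -l of the
    moment generating function of Z, which by independence is the product of
    those of the a_i X_i.  If its logarithm is O(p) there, then E|Z|^p <= (C p/l)^p ([moment_sum_le]); what
    remains is to bound the factors and to choose l.

    Let X be centered with s = ||X||_{Psi_alpha}.  For |t| s small, a second
    order expansion gives log E exp(tX) = O((ts)^2): the linear term vanishes
    and E exp(|X|/s) is bounded ([mgf_le_local]).  For all t, Young's
    inequality t x <= (|t|s)^beta/beta + (|x|/s)^alpha/alpha gives
    E exp(tX) <= 2 exp((|t|s)^beta) ([mgf_le_young]).  Together they yield, with
    a constant independent of alpha, log E exp(tX) = O((ts)^2 + |ts|^beta), and
    when alpha >= 2, hence beta <= 2, both O((ts)^2) and O(|ts|^beta).

    Put S = sum_i a_i^2 s_i^2 and let N be the beta-norm of (a_i s_i).  The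
    logarithm for Z is then O(l^2 S + (l N)^beta), or the smaller of the two
    terms when alpha >= 2.  The choice l = sqrt(p/S) makes the first term equal
    to p and p/l equal to p^(1/2) S^(1/2); the choice l = p^(1/beta)/N makes the
    second term equal to p and p/l equal to p^(1/alpha) N.  This settles
    alpha >= 2.

    For alpha < 2, put T = (N/sqrt S)^(2 alpha/(alpha-2)).  Since
    (alpha-2)/(2 alpha) = 1/2 - 1/alpha = 1/beta - 1/2, the other term is also
    at most p for the first choice when p <= T, and for the second choice when
    p >= T.  In the second case exp(-T) >= exp(-p), so the factor exp(-T) costs
    only a larger constant C_1.  For alpha = 1 there is only the
    expansion, valid for l max_i |a_i s_i| <= 1/2, and half of the same values
    of l fulfil this. *)

(** * Products of functions of independent random variables *)

Import HBNNSimple.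

(** Both sides are linear and continuous along increasing sequences as
    functionals of [h], so it suffices that they agree on indicators. Finiteness
    of [c] is what makes the right-hand side pass to the limit. *)
Lemma ge0_expectation_mul_comp (d : measure_display) (T : measurableType d)
    (R : realType) (P : probability T R) (G X : T -> R) (c : \bar R) :
  measurable_fun [set: T] G -> (forall w, 0 <= G w) ->
  measurable_fun [set: T] X -> (0 <= c)%E -> c \is a fin_num ->
  (forall B, measurable B ->
    ('E_P[fun w => (G w * \1_B (X w))%R] = c * P (X @^-1` B))%E) ->
  forall h : R -> R, measurable_fun [set: R] h -> (forall x, 0 <= h x) ->
  ('E_P[fun w => (G w * h (X w))%R] = c * 'E_P[fun w => h (X w)])%E.
Proof.
move=> mG G0 mX c0 cfin GX h mh h0.
have mXB B : measurable B -> measurable (X @^-1` B).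
  by move=> mB; rewrite -[_ @^-1` _]setTI; exact: mX.
have simple (f : {nnsfun R >-> R}) :
    ('E_P[fun w => (G w * f (X w))%R] = c * 'E_P[fun w => f (X w)])%E.
  have fX0 y x : 0 <= y * \1_(f @^-1` [set y]) x.
    exact: nnfun_muleindic_ge0.
  have mf y : measurable_fun [set: T]
      (fun w => y * \1_(f @^-1` [set y]) (X w)).
    apply: measurable_funM => //; apply: (measurableT_comp _ mX).
    exact: measurable_indic.
  have -> : (fun w => f (X w)) =
      (fun w => \sum_(y \in range f) y * \1_(f @^-1` [set y]) (X w)).
    by apply/funext => w; rewrite fimfunE.
  have -> : (fun w => G w * f (X w)) = (fun w =>
      \sum_(y \in range f) G w * (y * \1_(f @^-1` [set y]) (X w))).
    apply/funext => w; rewrite fimfunE.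
    by rewrite !fsbig_finite//= mulr_sumr.
  rewrite unlock.
  under [in LHS]eq_integral do rewrite -fsumEFin//.
  under [in RHS]eq_integral do rewrite -fsumEFin//.
  rewrite !ge0_integral_fsum//=; first last.
  - by move=> y w _; rewrite lee_fin mulr_ge0.
  - by move=> y; apply/measurable_EFinP; apply: measurable_funM.
  - by move=> y w _; rewrite lee_fin.
  - by move=> y; apply/measurable_EFinP.
  rewrite ge0_mule_fsumr; last first.
    by move=> y; apply: integral_ge0 => w _; rewrite lee_fin.
  apply: eq_fsbigr => y; rewrite inE => -[x _ <-]; set z := f x.
  under eq_integral do rewrite mulrCA EFinM.
  under [in RHS]eq_integral do rewrite EFinM.
  have mz : measurable (f @^-1` [set z]) by exact: measurable_funPTI.
  have mi : measurable_fun [set: T] (fun w => (\1_(f @^-1` [set z]) (X w) : R)).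
    by apply: (measurableT_comp _ mX); exact: measurable_indic.
  rewrite !ge0_integralZl//=; first last.
  - by rewrite lee_fin.
  - by move=> w _; rewrite lee_fin mulr_ge0.
  - by apply/measurable_EFinP; apply: measurable_funM.
  - by rewrite lee_fin.
  - by apply/measurable_EFinP.
  rewrite muleCA; congr (_ * _)%E.
  have := GX _ mz; rewrite unlock => ->; congr (_ * _)%E.
  by rewrite -[X in P X]setIT -integral_indic//; exact: mXB.
pose g := nnsfun_approx measurableT ((measurable_EFinP _ _).2 mh).
have cvg_g x : ((g n x)%:E @[n --> \oo] --> (h x)%:E)%E.
  by apply: cvg_nnsfun_approx => // y _; rewrite lee_fin.
have nd_g x : nondecreasing_seq (fun n => g n x).
  by move=> m n mn; exact/lefP/nd_nnsfun_approx.
have mgX n : measurable_fun [set: T] (fun w => g n (X w)).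
  exact: measurableT_comp.
have MCT (F : T -> R) : measurable_fun [set: T] F -> (forall w, 0 <= F w) ->
    ('E_P[fun w => (F w * g n (X w))%R] @[n --> \oo] -->
     'E_P[fun w => (F w * h (X w))%R])%E.
  move=> mF F0; rewrite unlock.
  have -> : (\int[P]_w (F w * h (X w))%:E =
      \int[P]_w limn (fun n => (F w * g n (X w))%:E))%E.
    apply: eq_integral => w _; apply/esym/cvg_lim => //.
    under eq_fun do rewrite EFinM.
    by rewrite EFinM; apply: cvgeZl => //.
  apply: cvg_monotone_convergence => //.
  - by move=> n; apply/measurable_EFinP; exact: measurable_funM.
  - by move=> n w _; rewrite lee_fin mulr_ge0.
  - by move=> w _ m n mn; rewrite lee_fin ler_wpM2l// nd_g.
have := MCT _ mG G0.
under eq_fun do rewrite simple.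
move=> /cvg_lim <- //; apply/cvg_lim => //.
apply: cvgeZl => //.
have := MCT (fun=> 1) (measurable_cst _) (fun=> ler01).
by rewrite unlock; under eq_fun do under eq_integral do rewrite mul1r;
  under [X in _ --> X]eq_integral do rewrite mul1r.
Qed.

(** Independence is the case where every [h i] is an indicator; the functions
    are replaced by general ones one coordinate at a time, in the order of the
    indices, by [ge0_expectation_mul_comp]. *)
Lemma expectation_prod_independent (d : measure_display)
    (T : measurableType d) (R : realType) (P : probability T R) (n : nat)
    (X : 'I_n -> {RV P >-> R}) (h : 'I_n -> R -> R) :
  mutually_independent X ->
  (forall i, measurable_fun [set: R] (h i)) ->
  (forall i x, 0 <= h i x) ->
  (forall i, 'E_P[fun w => h i (X i w)] \is a fin_num)%E ->
  ('E_P[fun w => (\prod_(i < n) h i (X i w))%R] =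
   \prod_(i < n) 'E_P[fun w => h i (X i w)])%E.
Proof.
move=> indep.
have meX i B : measurable B -> measurable (X i @^-1` B).
  by move=> mB; exact: measurable_funPTI.
have Eind i B : measurable B ->
    ('E_P[fun w => \1_B (X i w)] = P (X i @^-1` B))%E.
  by move=> mB; rewrite unlock -[X in P X]setIT -integral_indic//; exact: meX.
(* The invariant: only the coordinates below k are arbitrary functions. *)
suff main k : forall h : 'I_n -> R -> R,
    (forall i, measurable_fun [set: R] (h i)) ->
    (forall i x, 0 <= h i x) ->
    (forall i, 'E_P[fun w => h i (X i w)] \is a fin_num)%E ->
    (forall i : 'I_n, (k <= i)%N ->
      exists2 B : set R, measurable B & h i = \1_B) ->
  ('E_P[fun w => (\prod_(i < n) h i (X i w))%R] =
   \prod_(i < n) 'E_P[fun w => h i (X i w)])%E.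
  move=> mh h0 hfin; apply: (main n) => // i.
  by rewrite leqNgt ltn_ord.
elim: k => [|k IH] {}h mh h0 hfin hind.
  pose B i := h i @^-1` [set 1].
  have mB i : measurable (B i) by rewrite /B -[_ @^-1` _]setTI; exact: mh.
  have hE i : h i = \1_(B i).
    have [C mC hC] := hind i isT; rewrite hC; congr (\1_ _).
    apply/seteqP; split => x; rewrite /B /= hC indicE; first by move/mem_set ->.
    case: (boolP (x \in C)) => [/set_mem //|_ /= h01].
    by have := oner_neq0 R; rewrite -h01 eqxx.
  under [in RHS]eq_bigr do rewrite hE Eind//.
  have := indep [set: 'I_n]%SET B (fun i _ => mB i).
  rewrite (_ : \prod_(i in [set: 'I_n]%SET) _ = \prod_i P (X i @^-1` B i))%E;
    last by apply: eq_bigl => i; rewrite inE.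
  move=> <-.
  have mI : measurable (\bigcap_(i in [set` [set: 'I_n]%SET]) (X i @^-1` B i)).
    by apply: fin_bigcap_measurable => // i _; exact: meX.
  rewrite -[X in P X]setIT -integral_indic//.
  rewrite unlock; apply: eq_integral => w _; congr EFin.
  rewrite indicE; case: (boolP (w \in _)).
    rewrite inE => wB; rewrite big1// => i _.
    by rewrite hE indicE mem_set//; apply: wB => /=; rewrite inE.
  move=> /negP wB.
  have [i hi] : exists i, X i w \notin B i.
    apply: contra_notP wB => /forallNP wB; rewrite inE => i _ /=.
    by apply/set_mem; have /negP := wB i; rewrite negbK.
  by rewrite (bigD1 i)//= hE indicE (negbTE hi) mul0r.
have [nk|kn] := leqP n k.
  apply: IH => // i ki; case/negP: (ltn_geF (ltn_ord i)).
  exact: leq_trans ki.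
pose K := Ordinal kn.
rewrite [RHS](bigD1 K)//= muleC.
under [in LHS]eq_fun do rewrite (bigD1 K)//= mulrC.
have mhX i : measurable_fun [set: T] (fun w => h i (X i w)).
  exact: measurableT_comp.
apply: (@ge0_expectation_mul_comp _ _ _ P
   (fun w => \prod_(i < n | i != K) h i (X i w)) (X K)) => //.
- under eq_fun do rewrite -big_filter; exact: measurable_prod.
- by move=> w; apply: prodr_ge0.
- by apply: prode_ge0 => i _; exact: expectation_ge0.
- exact: prode_fin_num.
move=> B mB.
pose h' i := if i == K then \1_B else h i.
have h'K i : i != K -> h' i = h i by rewrite /h' => /negbTE ->.
have h'KK : h' K = \1_B by rewrite /h' eqxx.
have := IH h'.
rewrite (bigD1 K)//= h'KK Eind// muleC.
rewrite (eq_bigr (fun i => 'E_P[fun w => h i (X i w)])%E); last first.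
  by move=> i iK; rewrite h'K.
move=> <-.
- congr expectation; apply/funext => w; rewrite [RHS](bigD1 K)//= h'KK mulrC.
  by congr (_ * _); apply: eq_bigr => i iK; rewrite h'K.
- by move=> i; rewrite /h'; case: ifP.
- by move=> i x; rewrite /h'; case: ifP.
- move=> i; rewrite /h'; case: ifP => // _; rewrite Eind//.
  by apply: fin_num_measure; exact: meX.
- move=> i; rewrite leq_eqVlt => /predU1P[ki|ki].
    by exists B => //; rewrite (_ : i = K)//; apply/val_inj.
  by rewrite h'K; [exact: hind|apply: contraTneq ki => ->; rewrite ltnn].
Qed.

(** * Moment generating function of one variable *)

(** Two applications of [1 + y <= expR y]: at [- x] it gives
    [expR x - 1 - x <= x * (expR x - 1)], and at [x], for negative [x], it
    bounds the right-hand side by [x ^+ 2]. *)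
Lemma expR_le_taylor2 (R : realType) (x : R) :
  expR x <= 1 + x + x ^+ 2 * expR `|x|.
Proof.
have e1 : expR x - 1 <= x * expR x.
  have := expR_ge1Dx (- x); rewrite -(ler_pM2r (expR_gt0 x)).
  by rewrite -expRD addNr expR0; lra.
suff : x * (expR x - 1) <= x ^+ 2 * expR `|x|.
  by rewrite mulrBr; lra.
have [x0|x0] := leP 0 x.
  rewrite ger0_norm// expr2 -mulrA ler_wpM2l//.
have ex : 1 <= expR `|x| by have := expR_ge1Dx `|x|; have := normr_ge0 x; lra.
by have := expR_ge1Dx x; nra.
Qed.

Lemma sqr_le_expR_half (R : realType) (y : R) :
  0 <= y -> y ^+ 2 <= 8 * expR (y / 2).
Proof.
move=> y0; have y20 : 0 <= y / 2 by rewrite divr_ge0.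
have := expR_ge1Dxn 1 y20; rewrite exprMn (_ : 2`!%:R = 2)//.
by lra.
Qed.

Lemma le_1DpowR (R : realType) (y alpha : R) :
  0 <= y -> 1 <= alpha -> y <= 1 + y `^ alpha.
Proof.
move=> y0 a1; have [y1|y1] := leP y 1; first by rewrite ler_wpDr ?powR_ge0.
by rewrite ler_wpDl// le1r_powR// ltW.
Qed.

Lemma expR_le_expR_powR (R : realType) (y alpha : R) :
  0 <= y -> 1 <= alpha -> expR y <= expR 1 * expR (y `^ alpha).
Proof. by move=> y0 a1; rewrite -expRD ler_expR le_1DpowR. Qed.

Section mgf.
Variables (d : measure_display) (T : measurableType d) (R : realType).
Variables (P : probability T R) (X : {RV P >-> R}) (alpha : R).
Hypothesis alpha1 : 1 <= alpha.

Let mH v : measurable_fun [set: T] (fun w => expR ((`|X w| / v) `^ alpha)).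
Proof.
apply: measurableT_comp => //; apply: (measurableT_comp (measurable_powR _)).
by apply: measurable_funM => //; exact: measurableT_comp.
Qed.

Let mE t : measurable_fun [set: T] (fun w => expR (t * X w)).
Proof. by apply: measurableT_comp => //; exact: measurable_funM. Qed.

(** Monotonicity in [v] gives the defining inequality at every value above the
    infimum, whether or not the infimum itself satisfies it. *)
Lemma expectation_le_orlicz (v : R) : (orlicz_norm P alpha X < v%:E)%E ->
  0 < v /\ ('E_P[fun w => expR ((`|X w| / v) `^ alpha)] <= 2%:E)%E.
Proof.
move=> /ereal_inf_lt[_ [u [u0 Eu] <-]]; rewrite lte_fin => uv.
have v0 := lt_trans u0 uv.
split => //; apply: le_trans Eu; apply: expectation_le => //.
apply/aeW => w; rewrite ler_expR; apply: ge0_ler_powR.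
- exact: le_trans alpha1.
- by rewrite nnegrE divr_ge0// ltW.
- by rewrite nnegrE divr_ge0// ltW.
- by rewrite ler_wpM2l// lef_pV2 ?posrE// ltW.
Qed.

(** With y = |X|/v and |t|v <= 1/2, the remainder of the second order expansion
    of exp(tX) is at most (tv)^2 y^2 exp(y/2) <= 8 (tv)^2 exp(y), and
    exp(y) <= e exp(y^alpha), whose expectation is at most 2e. *)
Lemma mgf_le_local (t v : R) : 0 < v ->
  ('E_P[fun w => expR ((`|X w| / v) `^ alpha)] <= 2%:E)%E ->
  ('E_P[X] = 0)%E -> `|t| * v <= 2^-1 ->
  ('E_P[fun w => expR (t * X w)] <= (1 + 16 * expR 1 * (t * v) ^+ 2)%:E)%E.
Proof.
move=> v0 EH EX tv.
set H := fun w => expR ((`|X w| / v) `^ alpha).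
have H0 w : 0 <= H w by exact: expR_ge0.
pose c := 8 * expR 1 * (t * v) ^+ 2.
have HL : H \in Lfun P 1.
  apply/Lfun1_integrable/integrableP; split.
    by apply/measurable_EFinP; exact: mH.
  under eq_integral do rewrite /= ger0_norm//.
  by move: EH; rewrite unlock => /le_lt_trans; apply; rewrite ltry.
have ey w : expR (`|X w| / v) <= expR 1 * H w.
  by rewrite expR_le_expR_powR// divr_ge0// ltW.
have XL : (X : T -> R) \in Lfun P 1.
  apply/Lfun1_integrable.
  have /Lfun1_integrable iH := Lfun_scale (v * expR 1) (lexx 1) HL.
  apply: le_integrable iH => //; first exact/measurable_EFinP.
  move=> w _; rewrite /= lee_fin [leRHS]ger0_norm; last first.
    by rewrite !mulr_ge0 ?H0 ?expR_ge0 ?ltW.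
  rewrite (_ : _ * _ = v * (expR 1 * H w)); last by ring.
  rewrite -ler_pdivrMl// mulrC; apply: le_trans (ey w).
  by have := expR_ge1Dx (`|X w| / v); lra.
pose U : T -> R := cst 1 \+ (t \o* (X : T -> R)) \+ (c \o* H).
have key w : expR (t * X w) <= U w.
  have y0 : 0 <= `|X w| / v by rewrite divr_ge0// ltW.
  rewrite (le_trans (expR_le_taylor2 (t * X w)))// /U/= [X w * t]mulrC lerD2l.
  have -> : (t * X w) ^+ 2 = (t * v) ^+ 2 * (`|X w| / v) ^+ 2.
    by rewrite (exprMn _ `|X w|) real_normK ?num_real//; field; rewrite gt_eqF.
  have -> : `|t * X w| = (`|t| * v) * (`|X w| / v).
    by rewrite normrM; field; rewrite gt_eqF.
  have step : (`|X w| / v) ^+ 2 * expR (`|t| * v * (`|X w| / v)) <=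
      8 * expR 1 * H w.
    apply: (@le_trans _ _ (8 * expR (`|X w| / v / 2) * expR (`|X w| / v / 2))).
      apply: ler_pM; rewrite ?sqr_ge0 ?expR_ge0//.
        exact: sqr_le_expR_half.
      by rewrite ler_expR [leRHS]mulrC ler_wpM2r.
    by rewrite -mulrA -expRD -splitr -mulrA ler_pM2l.
  have := ler_wpM2l (sqr_ge0 (t * v)) step; rewrite /c; lra.
apply: (@le_trans _ _ ('E_P[U])%E).
  apply: expectation_le => //.
  - have mtX : measurable_fun [set: T] (fun w => X w * t).
      exact: measurable_funM.
    have mcH : measurable_fun [set: T] (fun w => H w * c).
      by apply: measurable_funM => //; exact: mH.
    by apply: (measurable_funD _ mcH); apply: (measurable_funD _ mtX).
  - by move=> w; apply: le_trans (key w); exact: expR_ge0.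
  - exact/aeW.
rewrite /U !expectationD ?rpredD ?(Lfun_scale _ (lexx 1)) ?Lfun_cst//.
rewrite expectation_cst !expectationZl// EX mule0 adde0 EFinD leeD2l//.
have -> : ((16 * expR 1 * (t * v) ^+ 2)%:E = c%:E * 2%:E)%E.
  by rewrite -EFinM; congr EFin; rewrite /c; ring.
apply: lee_wpmul2l => //.
by rewrite lee_fin /c mulr_ge0 ?sqr_ge0 ?mulr_ge0 ?expR_ge0.
Qed.

Lemma mgf_le_young (t v beta : R) : 0 < v -> 0 < beta ->
  alpha^-1 + beta^-1 = 1 ->
  ('E_P[fun w => expR ((`|X w| / v) `^ alpha)] <= 2%:E)%E ->
  ('E_P[fun w => expR (t * X w)] <= (2 * expR ((`|t| * v) `^ beta))%:E)%E.
Proof.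
move=> v0 beta0 ab EH; set H := fun w => expR ((`|X w| / v) `^ alpha) in EH *.
have alpha0 : 0 < alpha by exact: lt_le_trans alpha1.
have beta1 : beta^-1 <= 1.
  by have ia : 0 < alpha^-1; [rewrite invr_gt0|lra].
set c := expR ((`|t| * v) `^ beta).
have key w : expR (t * X w) <= c * H w.
  have y0 : 0 <= `|X w| / v by rewrite divr_ge0// ltW.
  have tv0 : 0 <= `|t| * v by rewrite mulr_ge0// ltW.
  rewrite /c /H -expRD ler_expR.
  apply: (@le_trans _ _ (`|X w| / v * (`|t| * v))).
    rewrite (_ : _ * (_ * _) = `|t * X w|) ?ler_norm//.
    by rewrite normrM; field; rewrite gt_eqF.
  apply: le_trans (conjugate_powR y0 tv0 alpha0 beta0 ab) _.
  rewrite addrC lerD//.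
    by rewrite ler_piMr ?powR_ge0.
  by rewrite ler_piMr ?powR_ge0// invf_le1.
apply: (@le_trans _ _ ('E_P[fun w => (c * H w)%R])%E).
  apply: expectation_le => //.
  - by apply: measurable_funM => //; exact: mH.
  - by move=> w; rewrite mulr_ge0 ?expR_ge0.
  - exact/aeW.
have -> : ('E_P[fun w => (c * H w)%R] = c%:E * 'E_P[H])%E.
  rewrite unlock -ge0_integralZl ?lee_fin ?expR_ge0//.
  - by apply/measurable_EFinP; exact: mH.
  - by move=> w _; rewrite lee_fin expR_ge0.
rewrite [2 * _]mulrC EFinM; apply: lee_wpmul2l => //.
by rewrite lee_fin expR_ge0.
Qed.

Hypothesis X0 : ('E_P[X] = 0)%E.
Hypothesis Xfin : (orlicz_norm P alpha X < +oo)%E.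
Let s : R := fine (orlicz_norm P alpha X).

Lemma orlicz_norm_ge0 : (0 <= orlicz_norm P alpha X)%E.
Proof. by apply: le_ereal_inf_tmp => _ [u [u0 _] <-]; rewrite lee_fin ltW. Qed.

Lemma fine_orlicz_norm_ge0 : 0 <= s.
Proof. exact/fine_ge0/orlicz_norm_ge0. Qed.

Let orlicz_ltP v : s < v -> (orlicz_norm P alpha X < v%:E)%E.
Proof.
by move=> sv; rewrite -[ltLHS]fineK ?lte_fin// ge0_fin_numE// orlicz_norm_ge0.
Qed.

(** A variable of norm zero vanishes almost surely; letting [v] tend to 0 in
    [mgf_le_local] gives the consequence that is needed. *)
Lemma mgf_orlicz_eq0 (t : R) : s = 0 ->
  ('E_P[fun w => expR (t * X w)] <= 1)%E.
Proof.
move=> s0; apply/lee_addgt0Pr => e e0.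
pose D := 16 * expR 1 * t ^+ 2 + 1.
have k0 : 0 <= 16 * expR 1 * t ^+ 2.
  by rewrite mulr_ge0 ?sqr_ge0// mulr_ge0 ?expR_ge0.
have D1 : 1 <= D by rewrite /D lerDr.
(* The first bound makes mgf_le_local applicable, the other two make the
   remainder at most e. *)
pose v := Num.min (2^-1 / (`|t| + 1)) (Num.min 1 (e / D)).
have t1 : 0 < `|t| + 1 by rewrite ltr_wpDl.
have v0 : 0 < v.
  by rewrite !lt_min ltr01 !divr_gt0//; exact: lt_le_trans D1.
have sv : s < v by rewrite s0.
have [_ Ev] := expectation_le_orlicz (orlicz_ltP sv).
have v1 : v <= 1 by rewrite !ge_min lexx orbT.
have ve : v <= e / D by rewrite !ge_min lexx !orbT.
have vt : v <= 2^-1 / (`|t| + 1) by rewrite !ge_min lexx.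
apply: le_trans (mgf_le_local v0 Ev X0 _) _.
  rewrite ler_pdivlMr// in vt; have := normr_ge0 t; nra.
rewrite -EFinD lee_fin lerD2l.
rewrite ler_pdivlMr in ve; last exact: lt_le_trans D1.
apply: le_trans ve; rewrite exprMn /D.
have vv : v ^+ 2 <= v by rewrite expr2 ler_piMr// ltW.
nra.
Qed.

(** The halved argument pays for applying [mgf_le_local] at [v = 2 * s], the
    Orlicz condition being available strictly above the norm [s]. *)
Lemma mgf_orlicz_local (t : R) : `|t * s| <= 2^-1 ->
  ('E_P[fun w => expR (t / 2 * X w)] <=
    (expR (16 * expR 1 * (t * s) ^+ 2))%:E)%E.
Proof.
move=> ts; have := fine_orlicz_norm_ge0; rewrite -/s le_eqVlt.
move=> /predU1P[s0|s0].
  apply: le_trans (mgf_orlicz_eq0 _ _) _ => //.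
  by rewrite -s0 mulr0 expr0n/= mulr0 expR0.
have sv : s < 2 * s by lra.
have [_ Ev] := expectation_le_orlicz (orlicz_ltP sv).
apply: le_trans (mgf_le_local _ Ev X0 _) _; first by rewrite mulr_gt0.
  move: ts; rewrite !normrM (gtr0_norm s0) (gtr0_norm (_ : 0 < 2^-1))//; lra.
rewrite lee_fin (_ : t / 2 * (2 * s) = t * s); last by field.
exact: expR_ge1Dx.
Qed.

Lemma mgf_orlicz_young (t beta : R) : 0 < beta -> alpha^-1 + beta^-1 = 1 ->
  ('E_P[fun w => expR (t / 2 * X w)] <= (2 * expR (`|t * s| `^ beta))%:E)%E.
Proof.
move=> b0 ab; have := fine_orlicz_norm_ge0; rewrite -/s le_eqVlt.
move=> /predU1P[s0|s0].
  apply: le_trans (mgf_orlicz_eq0 _ _) _ => //.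
  rewrite lee_fin; have : 0 <= `|t * s| `^ beta by exact: powR_ge0.
  by have := expR_ge1Dx (`|t * s| `^ beta); lra.
have sv : s < 2 * s by lra.
have [_ Ev] := expectation_le_orlicz (orlicz_ltP sv).
apply: le_trans (mgf_le_young _ _ b0 ab Ev) _; first by rewrite mulr_gt0.
rewrite (_ : `|t / 2| * (2 * s) = `|t * s|)//.
by rewrite !normrM (gtr0_norm s0) (gtr0_norm (_ : 0 < 2^-1))//; field.
Qed.

End mgf.

(** The constant of the quadratic regime; being at least 16, it also serves the
    other regimes. *)
Definition mgf_const {R : realType} : R := 16 * expR 1.

Lemma mgf_const_ge16 (R : realType) : 16 <= @mgf_const R.
Proof. by rewrite /mgf_const; have := expR_ge1Dx (1 : R); lra. Qed.

Section mgf_all_range.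
Variables (d : measure_display) (T : measurableType d) (R : realType).
Variables (P : probability T R) (X : {RV P >-> R}) (alpha beta : R).
Hypothesis alpha1 : 1 <= alpha.
Hypothesis beta0 : 0 < beta.
Hypothesis alphabeta : alpha^-1 + beta^-1 = 1.
Hypothesis X0 : ('E_P[X] = 0)%E.
Hypothesis Xfin : (orlicz_norm P alpha X < +oo)%E.
Let s : R := fine (orlicz_norm P alpha X).

(** Once |ts| exceeds 1/2, the factor 2 of the Young bound is at most e and is
    absorbed in the exponent. *)
Let mgf_le_by_cases (t phi : R) :
  (`|t * s| <= 2^-1 -> (t * s) ^+ 2 * mgf_const <= phi) ->
  (2^-1 < `|t * s| -> 1 + `|t * s| `^ beta <= phi) ->
  ('E_P[fun w => expR (t / 2 * X w)%R] <= (expR phi)%:E)%E.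
Proof.
move=> small large; have [ts|ts] := leP `|t * s| 2^-1.
  apply: le_trans (mgf_orlicz_local alpha1 X0 Xfin ts) _.
  by rewrite lee_fin ler_expR mulrC small.
apply: le_trans (mgf_orlicz_young alpha1 X0 Xfin t beta0 alphabeta) _.
rewrite lee_fin; apply: le_trans (_ : expR 1 * expR (`|t * s| `^ beta) <= _).
  by rewrite ler_pM2r ?expR_gt0//; have := expR_ge1Dx (1 : R); lra.
by rewrite -expRD ler_expR large.
Qed.

Lemma mgf_le_mixed (t : R) :
  ('E_P[fun w => expR (t / 2 * X w)%R] <=
    (expR (mgf_const * ((t * s) ^+ 2 + `|t * s| `^ beta)))%:E)%E.
Proof.
have K := mgf_const_ge16 R; have q := powR_ge0 `|t * s| beta.
have r := sqr_ge0 (t * s).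
apply: mgf_le_by_cases => ts.
  by rewrite mulrC ler_wpM2l ?lerDl//; lra.
have : 4^-1 <= (t * s) ^+ 2 by rewrite -real_normK ?num_real//; nra.
nra.
Qed.

Hypothesis alpha2 : 2 <= alpha.

Let one_powR : 1 `^ beta = 1 :> R.
Proof. by rewrite powR1. Qed.

Let beta2 : beta <= 2.
Proof.
have a0 : 0 < alpha by exact: lt_le_trans alpha1.
have a2 : alpha^-1 <= 2^-1 by rewrite lef_pV2 ?posrE.
by rewrite -lef_pV2 ?posrE//; move: alphabeta; lra.
Qed.

Lemma mgf_le_gauss (t : R) :
  ('E_P[fun w => expR (t / 2 * X w)%R] <=
    (expR (mgf_const * (t * s) ^+ 2))%:E)%E.
Proof.
have K := mgf_const_ge16 R.
apply: mgf_le_by_cases => ts; first by rewrite mulrC.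
have : `|t * s| `^ beta <= 1 + (t * s) ^+ 2.
  have [t1|t1] := leP `|t * s| 1.
    rewrite ler_wpDr ?sqr_ge0// -[leRHS]one_powR ge0_ler_powR ?nnegrE//.
    exact: ltW.
  rewrite ler_wpDl// -real_normK ?num_real// -powR_mulrn//.
  by rewrite ler_powR// ltW.
have : 4^-1 <= (t * s) ^+ 2 by rewrite -real_normK ?num_real//; nra.
nra.
Qed.

Lemma mgf_le_powR (t : R) :
  ('E_P[fun w => expR (t / 2 * X w)%R] <=
    (expR (mgf_const * `|t * s| `^ beta))%:E)%E.
Proof.
have K := mgf_const_ge16 R; have q := powR_ge0 `|t * s| beta.
have sq1 : `|t * s| <= 1 -> (t * s) ^+ 2 <= `|t * s| `^ beta.
  move=> t1; rewrite -real_normK ?num_real//.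
  have := normr_ge0 (t * s); rewrite le_eqVlt => /predU1P[<-|t0].
    by rewrite expr0n powR_ge0.
  by rewrite -powR_mulrn// ger_powR// t0.
apply: mgf_le_by_cases => ts.
  by rewrite mulrC ler_wpM2l ?sq1//; lra.
have : 4^-1 <= `|t * s| `^ beta.
  have [t1|t1] := leP `|t * s| 1.
    by apply: le_trans (sq1 t1); rewrite -real_normK ?num_real//; nra.
  apply: (@le_trans _ _ 1); first lra.
  by rewrite -[leLHS]one_powR ge0_ler_powR ?nnegrE// ltW.
nra.
Qed.

End mgf_all_range.

(** * From exponential to polynomial moments *)

(** The pointwise bound |z|^p <= (p/l)^p exp(l|z|) is the p-th power of
    y <= exp(y) at y = l|z|/p. *)
Lemma moment_le_mgf (d : measure_display) (T : measurableType d)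
    (R : realType) (P : probability T R) (Z : T -> R) (l p M : R) :
  measurable_fun [set: T] Z -> 0 < l -> 1 <= p ->
  ('E_P[fun w => expR (l * Z w)%R] <= M%:E)%E ->
  ('E_P[fun w => expR (- l * Z w)%R] <= M%:E)%E ->
  ('E_P[fun w => (`|Z w| `^ p)%R] <= ((p / l) `^ p * (2 * M))%:E)%E.
Proof.
move=> mZ l0 p1 Mp Mn; have p0 : 0 < p by exact: lt_le_trans p1.
have pl0 : 0 <= p / l by rewrite divr_ge0 ?ltW.
have mexp t : measurable_fun [set: T] (fun w => expR (t * Z w)).
  by apply: measurableT_comp => //; exact: measurable_funM.
pose U w := (p / l) `^ p * (expR (l * Z w) + expR (- l * Z w)).
have key w : `|Z w| `^ p <= U w.
  apply: (@le_trans _ _ ((p / l) `^ p * expR (l * `|Z w|))).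
    rewrite {1}(_ : `|Z w| = p / l * (l * `|Z w| / p)); last first.
      by field; rewrite !gt_eqF.
    have q0 : 0 <= l * `|Z w| / p.
      by rewrite divr_ge0 ?mulr_ge0 ?(ltW l0) ?(ltW p0).
    rewrite powRM// ler_wpM2l ?powR_ge0//.
    rewrite [X in expR X](_ : _ = (l * `|Z w| / p) * p); last first.
      by field; rewrite gt_eqF.
    rewrite expRM ge0_ler_powR ?nnegrE ?expR_ge0 ?(ltW p0)//.
    by have := expR_ge1Dx (l * `|Z w| / p); lra.
  rewrite ler_wpM2l ?powR_ge0//.
  have [z0|z0] := leP 0 (Z w).
    by rewrite ger0_norm// lerDl expR_ge0.
  by rewrite ltr0_norm// mulrN -mulNr lerDr expR_ge0.
apply: (@le_trans _ _ ('E_P[U])%E).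
  apply: expectation_le => //.
  - by apply: (measurableT_comp (measurable_powR _)); exact: measurableT_comp.
  - by apply: measurable_funM => //; exact: measurable_funD.
  - by move=> w; apply: le_trans (key w); exact: powR_ge0.
  - exact/aeW.
have -> : ('E_P[U] = ((p / l) `^ p)%:E *
    ('E_P[fun w => expR (l * Z w)%R] + 'E_P[fun w => expR (- l * Z w)%R]))%E.
  rewrite unlock -ge0_integralD//; last 2 first.
  - exact/measurable_EFinP.
  - exact/measurable_EFinP.
  rewrite -ge0_integralZl ?lee_fin ?powR_ge0//.
  - by apply/emeasurable_funD; exact/measurable_EFinP.
  - by move=> w _; rewrite -EFinD lee_fin addr_ge0 ?expR_ge0.
rewrite EFinM; apply: lee_wpmul2l; first by rewrite lee_fin powR_ge0.
by rewrite mulrDl mul1r EFinD leeD.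
Qed.

(** The constant 4 absorbs, because p >= 1, both the number 2 of moment generating
    functions and the halving of [l]. *)
Lemma moment_sum_le (d : measure_display) (T : measurableType d)
    (R : realType) (P : probability T R) (n : nat) (X : 'I_n -> {RV P >-> R})
    (a phi : 'I_n -> R) (l p L : R) :
  mutually_independent X -> 0 < l -> 1 <= p ->
  (forall t i, `|t| = l ->
    ('E_P[fun w => expR (t * a i / 2 * X i w)%R] <= (expR (phi i))%:E)%E) ->
  \sum_(i < n) phi i <= L * p ->
  ('E_P[fun w => (`|\sum_(i < n) a i * X i w| `^ p)%R] <=
    ((4 * expR L * (p / l)) `^ p)%:E)%E.
Proof.
move=> indep l0 p1 mgfX sphi; have p0 : 0 < p by exact: lt_le_trans p1.
have mX i : measurable_fun [set: T] (X i) by [].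
have mZ : measurable_fun [set: T] (fun w => \sum_(i < n) a i * X i w).
  by apply: measurable_sum => i; exact: measurable_funM.
have mgfZ t : `|t| = l ->
    ('E_P[fun w => expR (t / 2 * \sum_(i < n) a i * X i w)%R] <=
     (expR (L * p))%:E)%E.
  move=> tl; pose h i x := expR (t * a i / 2 * x).
  have -> : (fun w => expR (t / 2 * \sum_(i < n) a i * X i w)) =
            (fun w => \prod_(i < n) h i (X i w)).
    apply/funext => w; rewrite -expR_sum mulr_sumr.
    by congr expR; apply: eq_bigr => i _; ring.
  have E0 i : (0 <= 'E_P[fun w => h i (X i w)])%E.
    by apply: expectation_ge0 => w; exact: expR_ge0.
  rewrite expectation_prod_independent//; last 3 first.
  - by move=> i; apply: measurableT_comp => //; exact: measurable_funM.
  - by move=> i x; exact: expR_ge0.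
  - move=> i; rewrite ge0_fin_numE//.
    by apply: le_lt_trans (mgfX t i tl) _; rewrite ltry.
  apply: (@le_trans _ _ (\prod_(i < n) (expR (phi i))%:E)%E).
    suff : (0 <= \prod_(i < n) 'E_P[fun w => h i (X i w)] <=
        \prod_(i < n) (expR (phi i))%:E)%E by case/andP.
    elim/big_ind2 : _ => [|x1 x2 y1 y2|i _].
    - by rewrite lee01 lexx.
    - move=> /andP[x10 x12] /andP[y10 y12].
      by rewrite mule_ge0//= lee_pmul.
    - by rewrite E0 mgfX.
  by rewrite prodEFin lee_fin -expR_sum ler_expR.
have l20 : 0 < l / 2 by rewrite divr_gt0.
have := @moment_le_mgf _ _ _ P _ (l / 2) p (expR (L * p)) mZ l20 p1.
rewrite -mulNr => /(_ (mgfZ _ (gtr0_norm l0))).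
have nl : `|- l| = l by rewrite normrN gtr0_norm.
move=> /(_ (mgfZ _ nl)) /le_trans; apply; rewrite lee_fin.
rewrite (_ : 4 * expR L * (p / l) = p / (l / 2) * (2 * expR L)); last first.
  by field; rewrite gt_eqF.
have pl20 : 0 <= p / (l / 2) by apply: divr_ge0; exact: ltW.
have e0 : 0 <= 2 * expR L by rewrite mulr_ge0 ?expR_ge0.
rewrite [leRHS](powRM _ pl20 e0).
rewrite ler_wpM2l ?powR_ge0// powRM ?expR_ge0// -expRM.
by rewrite ler_wpM2r ?expR_ge0// le1r_powR// ler1n.
Qed.

(** * Admissible values of l for the sum *)

Lemma sqr_powR_half (R : realType) (x : R) : 0 < x -> (x `^ 2^-1) ^+ 2 = x.
Proof.
move=> x0; rewrite -powR_mulrn ?powR_ge0// -powRrM mulVf// powRr1//.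
exact: ltW.
Qed.

Section independent_sum.
Variables (d : measure_display) (T : measurableType d) (R : realType).
Variables (P : probability T R) (n : nat) (X : 'I_n -> {RV P >-> R}).
Variables (alpha : R) (a : 'I_n -> R) (p : R).
Hypothesis indep : mutually_independent X.
Hypothesis X0 : forall i, ('E_P[X i] = 0)%E.
Hypothesis alpha1 : 1 <= alpha.
Hypothesis Xfin : forall i, (orlicz_norm P alpha (X i) < +oo)%E.
Hypothesis p1 : 1 <= p.
Let psi i := fine (orlicz_norm P alpha (X i)).
Let S := \sum_(i < n) a i ^+ 2 * psi i ^+ 2.
Let M := ('E_P[fun w => (`|\sum_(i < n) a i * X i w| `^ p)%R])%E.

Let D : R := 4 * expR (2 * mgf_const).

Let psi0 i : 0 <= psi i.
Proof. exact: fine_orlicz_norm_ge0. Qed.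

Let p0 : 0 < p.
Proof. exact: lt_le_trans p1. Qed.

Let K0 : 0 <= @mgf_const R.
Proof. by rewrite mulr_ge0 ?expR_ge0. Qed.

Let scaleS l : \sum_(i < n) (l * (a i * psi i)) ^+ 2 = l ^+ 2 * S.
Proof. by rewrite /S mulr_sumr; apply: eq_bigr => i _; ring. Qed.

Let scaleN l b : 0 < l -> 0 < b ->
  \sum_(i < n) `|l * (a i * psi i)| `^ b = (l * weighted_norm b%:E a psi) `^ b.
Proof.
move=> l0 b0; rewrite powRM ?powR_ge0 ?ltW//= -powRrM mulVf ?gt_eqF//.
rewrite powRr1; last by rewrite sumr_ge0// => i _; rewrite mulr_ge0 ?powR_ge0.
rewrite mulr_sumr; apply: eq_bigr => i _.
rewrite 2!normrM powRM ?mulr_ge0// powRM// (gtr0_norm l0) (ger0_norm (psi0 i)).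
by [].
Qed.

Let normE t i l : `|t| = l -> `|t * a i * psi i| = `|l * (a i * psi i)|.
Proof. by move=> <-; rewrite !normrM normr_id mulrA. Qed.

Let sqrE t i l : `|t| = l -> (t * a i * psi i) ^+ 2 = (l * (a i * psi i)) ^+ 2.
Proof.
move=> /(normE i) tl.
by rewrite -real_normK ?num_real// tl real_normK ?num_real.
Qed.

(** In each of the next four lemmas the hypotheses bound the sum of the exponents
    of the factors by [2 * mgf_const * p]; [D] is the resulting constant. *)
Lemma moment_le_local (l : R) : 0 < l ->
  (forall i, l * `|a i * psi i| <= 2^-1) -> l ^+ 2 * S <= 2 * p ->
  (M <= ((D * (p / l)) `^ p)%:E)%E.
Proof.
move=> l0 lb lS; apply: (@moment_sum_le _ _ _ P n X a
  (fun i => mgf_const * (l * (a i * psi i)) ^+ 2)) => //.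
  move=> t i tl; rewrite -(sqrE _ tl); apply: mgf_orlicz_local => //.
  by rewrite (normE _ tl) normrM (gtr0_norm l0).
by rewrite -mulr_sumr scaleS; have := ler_wpM2l K0 lS; lra.
Qed.

Lemma moment_le_mixed (l b : R) : 0 < l -> 0 < b -> alpha^-1 + b^-1 = 1 ->
  l ^+ 2 * S <= p -> (l * weighted_norm b%:E a psi) `^ b <= p ->
  (M <= ((D * (p / l)) `^ p)%:E)%E.
Proof.
move=> l0 b0 ab lS lN; apply: (@moment_sum_le _ _ _ P n X a
  (fun i => mgf_const * ((l * (a i * psi i)) ^+ 2 + `|l * (a i * psi i)| `^ b)))
  => //.
  move=> t i tl; rewrite -(sqrE _ tl) -(normE _ tl).
  exact: mgf_le_mixed.
rewrite -mulr_sumr big_split/= scaleS scaleN//.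
by have := ler_wpM2l K0 (lerD lS lN); lra.
Qed.

Lemma moment_le_gauss (l b : R) : 0 < l -> 0 < b -> alpha^-1 + b^-1 = 1 ->
  2 <= alpha -> l ^+ 2 * S <= p ->
  (M <= ((D * (p / l)) `^ p)%:E)%E.
Proof.
move=> l0 b0 ab a2 lS; apply: (@moment_sum_le _ _ _ P n X a
  (fun i => mgf_const * (l * (a i * psi i)) ^+ 2)) => //.
  move=> t i tl; rewrite -(sqrE _ tl).
  exact: (mgf_le_gauss alpha1 b0).
rewrite -mulr_sumr scaleS.
by have := mulr_ge0 K0 (ltW p0); have := ler_wpM2l K0 lS; lra.
Qed.

Lemma moment_le_powR (l b : R) : 0 < l -> 0 < b -> alpha^-1 + b^-1 = 1 ->
  2 <= alpha -> (l * weighted_norm b%:E a psi) `^ b <= p ->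
  (M <= ((D * (p / l)) `^ p)%:E)%E.
Proof.
move=> l0 b0 ab a2 lN; apply: (@moment_sum_le _ _ _ P n X a
  (fun i => mgf_const * `|l * (a i * psi i)| `^ b)) => //.
  move=> t i tl; rewrite -(normE _ tl).
  exact: mgf_le_powR.
rewrite -mulr_sumr scaleN//.
by have := mulr_ge0 K0 (ltW p0); have := ler_wpM2l K0 lN; lra.
Qed.

(** All summands have norm zero, so every [l] is admissible and the bound tends
    to 0 as [l] grows. *)
Lemma moment_degenerate : S = 0 -> (M <= 0)%E.
Proof.
move=> S0; have b0 i : a i * psi i = 0.
  have /psumr_eq0P : forall i, true -> 0 <= a i ^+ 2 * psi i ^+ 2.
    by move=> j _; rewrite mulr_ge0 ?sqr_ge0.
  move=> /(_ S0 i isT)/eqP; rewrite -exprMn sqrf_eq0 => /eqP //.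
have D0 : 0 < D by rewrite mulr_gt0 ?expR_gt0.
apply/lee_addgt0Pr => e e0; rewrite add0e.
have ep0 : 0 < e `^ p^-1 by rewrite powR_gt0.
(* The value of l that makes the bound equal to e. *)
have l0 : 0 < D * p / e `^ p^-1 by exact: divr_gt0 (mulr_gt0 D0 p0) ep0.
apply: le_trans (moment_le_local l0 _ _) _.
- by move=> i; rewrite b0 normr0 mulr0 invr_ge0.
- by rewrite S0 mulr0 mulr_ge0// ltW.
rewrite lee_fin (_ : D * _ = e `^ p^-1); last first.
  by field; rewrite !gt_eqF.
by rewrite -powRrM mulVf ?gt_eqF// powRr1// ltW.
Qed.

Let S_ge0 : 0 <= S.
Proof. by apply: sumr_ge0 => i _; rewrite mulr_ge0 ?sqr_ge0. Qed.

Lemma exists_summand_neq0 : S != 0 -> exists i, 0 < `|a i * psi i|.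
Proof.
move=> /eqP S0; apply: contra_notP S0 => /forallNP b0.
rewrite /S big1// => i _; have /negP := b0 i.
by rewrite normr_gt0 negbK -exprMn => /eqP ->; rewrite expr0n.
Qed.

Lemma weighted_norm_gt0 (b : R) : 0 < b -> S != 0 ->
  0 < weighted_norm b%:E a psi.
Proof.
move=> b0 /exists_summand_neq0[i bi]; rewrite /= powR_gt0// (bigD1 i)//=.
rewrite ltr_wpDr//; first by apply: sumr_ge0 => j _; rewrite mulr_ge0 ?powR_ge0.
by rewrite -powRM// powR_gt0// -(ger0_norm (psi0 i)) -normrM.
Qed.

Lemma weighted_normy_ge (i : 'I_n) :
  `|a i * psi i| <= weighted_norm +oo%E a psi.
Proof.
rewrite /= normrM (ger0_norm (psi0 i)).
exact: (le_bigmax _ (fun i => `|a i| * psi i)).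
Qed.

End independent_sum.

(** * Choice of l *)

(** The comparison of [p] with the threshold, solved for the ratio of the two
    norms; the exponent being negative, inequalities are reversed. *)
Lemma powR_le_of_le_powR (R : realType) (x y g : R) : 0 < x -> 0 < y -> g < 0 ->
  (x <= y `^ g -> y <= x `^ g^-1) /\ (y `^ g <= x -> x `^ g^-1 <= y).
Proof.
move=> x0 y0 g0; have gi0 : 0 <= - g^-1 by rewrite oppr_ge0 invr_le0 ltW.
have yg : (y `^ g) `^ (- g^-1) = y^-1.
  by rewrite -powRrM mulrN mulfV ?lt_eqF// powR_inv1// ltW.
have xg : x `^ g^-1 = (x `^ (- g^-1))^-1 by rewrite -powRN opprK.
split=> [xy|yx].
  have := ge0_ler_powR gi0 (ltW x0 : x \in Num.nneg) (powR_ge0 y g) xy.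
  by rewrite yg xg -[leLHS]invrK lef_pV2// posrE ?invr_gt0// powR_gt0.
have := ge0_ler_powR gi0 (powR_ge0 y g) (ltW x0 : x \in Num.nneg) yx.
by rewrite yg xg -[leRHS]invrK lef_pV2// posrE ?invr_gt0// powR_gt0.
Qed.

Section optimize.
Variables (d : measure_display) (T : measurableType d) (R : realType).
Variables (P : probability T R) (n : nat) (X : 'I_n -> {RV P >-> R}).
Variables (alpha : R) (a : 'I_n -> R) (p : R).
Hypothesis indep : mutually_independent X.
Hypothesis X0 : forall i, ('E_P[X i] = 0)%E.
Hypothesis alpha1 : 1 <= alpha.
Hypothesis Xfin : forall i, (orlicz_norm P alpha (X i) < +oo)%E.
Hypothesis p1 : 1 <= p.
Let psi i := fine (orlicz_norm P alpha (X i)).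
Let S := \sum_(i < n) a i ^+ 2 * psi i ^+ 2.
Let M := ('E_P[fun w => (`|\sum_(i < n) a i * X i w| `^ p)%R])%E.
Hypothesis S0 : 0 < S.

Let D : R := 4 * expR (2 * mgf_const).

Let p0 : 0 < p.
Proof. exact: lt_le_trans p1. Qed.

Let pn0 : p != 0.
Proof. by rewrite gt_eqF. Qed.

Let sp : R := p `^ 2^-1.
Let sS : R := S `^ 2^-1.
Let sp0 : 0 < sp. Proof. by rewrite powR_gt0. Qed.
Let sS0 : 0 < sS. Proof. by rewrite powR_gt0. Qed.
Let sp2 : sp ^+ 2 = p. Proof. exact: sqr_powR_half. Qed.
Let sS2 : sS ^+ 2 = S. Proof. exact: sqr_powR_half. Qed.

Let pg : p / (sp / sS) = sp * sS.
Proof.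
have h (x y : R) : 0 < x -> 0 < y -> x ^+ 2 / (x / y) = x * y.
  by move=> x0 y0; field; rewrite !gt_eqF.
by rewrite -(h sp sS)// sp2.
Qed.

(** The choice l = sqrt(p/S). *)
Lemma moment_gauss b : 0 < b -> alpha^-1 + b^-1 = 1 -> 2 <= alpha ->
  (M <= ((D * (sp * sS)) `^ p)%:E)%E.
Proof.
move=> b0 ab a2; have l0 : 0 < sp / sS by rewrite divr_gt0.
rewrite -pg; apply: (moment_le_gauss indep X0 alpha1 Xfin p1 l0 b0 ab a2).
by rewrite -/S expr_div_n sp2 sS2 divfK// gt_eqF.
Qed.

Section finite_beta.
Variable b : R.
Hypothesis b0 : 0 < b.
Hypothesis ab : alpha^-1 + b^-1 = 1.
Let N := weighted_norm b%:E a psi.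

Let N0 : 0 < N. Proof. by apply: weighted_norm_gt0 => //; rewrite gt_eqF. Qed.

Let lN : ((p `^ b^-1 / N) * N) `^ b = p.
Proof. by rewrite divfK ?gt_eqF// -powRrM mulVf ?gt_eqF// powRr1// ltW. Qed.

Let pl : p / (p `^ b^-1 / N) = p `^ alpha^-1 * N.
Proof.
have pb : 0 < p `^ b^-1 by rewrite powR_gt0.
have -> : p `^ alpha^-1 = p / p `^ b^-1.
  rewrite -[X in X / _](powRr1 (ltW p0)) -powRB ?pn0 ?implybT//.
  by congr (_ `^ _); move: ab; lra.
by field; rewrite !gt_eqF.
Qed.

Let l0 : 0 < p `^ b^-1 / N. Proof. exact: divr_gt0 (powR_gt0 _ p0) N0. Qed.

(** The choice l = p^(1/b)/N. *)
Lemma moment_powR : 2 <= alpha ->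
  (M <= ((D * (p `^ alpha^-1 * N)) `^ p)%:E)%E.
Proof.
move=> a2; rewrite -pl.
apply: (moment_le_powR indep X0 alpha1 Xfin p1 l0 b0 ab a2).
by rewrite -[leLHS]/((p `^ b^-1 / N * N) `^ b) lN.
Qed.

(** With l = sqrt(p/S), the term (lN)^b is at most p as the hypothesis bounds
    lN = sqrt(p) N/sqrt(S) by p^(1 - 1/alpha) = p^(1/b). *)
Lemma moment_gauss_below_threshold : N / sS <= p `^ (2^-1 - alpha^-1) ->
  (M <= ((D * (sp * sS)) `^ p)%:E)%E.
Proof.
move=> rho; have l0' : 0 < sp / sS by rewrite divr_gt0.
rewrite -pg; apply: (moment_le_mixed indep X0 alpha1 Xfin p1 l0' b0 ab).
  by rewrite -/S expr_div_n sp2 sS2 divfK// gt_eqF.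
rewrite -[leLHS]/((sp / sS * N) `^ b) mulrAC -mulrA.
apply: (@le_trans _ _ ((sp * p `^ (2^-1 - alpha^-1)) `^ b)).
  rewrite ge0_ler_powR ?nnegrE ?(ltW b0)//.
  - by rewrite mulr_ge0 ?divr_ge0 ?ltW.
  - by rewrite mulr_ge0 ?powR_ge0 ?ltW.
  - by rewrite ler_wpM2l// ltW.
rewrite -powRD ?pn0 ?implybT// -powRrM.
have -> : 2^-1 + (2^-1 - alpha^-1) = b^-1 by move: ab; lra.
by rewrite mulVf ?gt_eqF// powRr1// ltW.
Qed.

(** With l = p^(1/b)/N, the term l^2 S is at most p: the hypothesis bounds
    l sqrt(S) = p^(1/b) sqrt(S)/N by p^(1/b - 1/2 + 1/alpha) = p^(1/2). *)
Lemma moment_powR_above_threshold : p `^ (2^-1 - alpha^-1) <= N / sS ->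
  (M <= ((D * (p `^ alpha^-1 * N)) `^ p)%:E)%E.
Proof.
move=> rho; rewrite -pl.
apply: (moment_le_mixed indep X0 alpha1 Xfin p1 l0 b0 ab); last first.
  by rewrite -[leLHS]/((p `^ b^-1 / N * N) `^ b) lN.
rewrite -/S -sS2 -exprMn -[leRHS]sp2.
have -> : p `^ b^-1 / N * sS = p `^ b^-1 / (N / sS).
  by field; rewrite !gt_eqF.
rewrite ler_sqr ?nnegrE; [|by rewrite !divr_ge0 ?powR_ge0 ?ltW|exact: ltW].
rewrite ler_pdivrMr ?divr_gt0//.
apply: le_trans (ler_wpM2l (ltW sp0) rho).
rewrite -powRD ?pn0 ?implybT// ler_powR//.
by move: ab; lra.
Qed.

End finite_beta.

Section infinite_beta.
Hypothesis alphaE : alpha = 1.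
Let N := weighted_norm +oo%E a psi.

Let N0 : 0 < N.
Proof.
have [i bi] := exists_summand_neq0 (negbT (gt_eqF S0)).
by apply: lt_le_trans bi _; exact: weighted_normy_ge.
Qed.

Let spN : sp * p `^ (2^-1 - alpha^-1) = 1.
Proof.
rewrite -powRD ?pn0 ?implybT// (_ : _ + _ = 0) ?powRr0//.
by rewrite alphaE invr1; lra.
Qed.

(** Here l = sqrt(p/S)/2, and the hypothesis keeps every l |a_i s_i| at most
    1/2. *)
Lemma moment_gauss_below_threshold1 : N / sS <= p `^ (2^-1 - alpha^-1) ->
  (M <= ((D * (2 * (sp * sS))) `^ p)%:E)%E.
Proof.
move=> rho; have l0 : 0 < sp / sS / 2 by rewrite !divr_gt0.
rewrite (_ : 2 * (sp * sS) = p / (sp / sS / 2)); last first.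
  by rewrite -pg; field; rewrite !gt_eqF.
apply: (moment_le_local indep X0 alpha1 Xfin p1 l0).
- move=> i; apply: (@le_trans _ _ (sp / sS / 2 * N)).
    by rewrite ler_wpM2l ?(ltW l0)//; exact: weighted_normy_ge.
  have := ler_wpM2l (ltW sp0) rho; rewrite spN.
  rewrite (_ : sp / sS / 2 * N = sp * (N / sS) / 2); first lra.
  by field; rewrite gt_eqF.
- rewrite -/S !expr_div_n sp2 sS2 mulrAC divfK ?gt_eqF//.
  have : 0 < p by []. lra.
Qed.

(** Here l = 1/(2N), the largest value for which every l |a_i s_i| is at most
    1/2. *)
Lemma moment_powR_above_threshold1 : p `^ (2^-1 - alpha^-1) <= N / sS ->
  (M <= ((D * (2 * (p `^ alpha^-1 * N))) `^ p)%:E)%E.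
Proof.
move=> rho; have l0 : 0 < N^-1 / 2 by rewrite divr_gt0 ?invr_gt0.
rewrite (_ : 2 * (_ * N) = p / (N^-1 / 2)); last first.
  by rewrite alphaE invr1 powRr1 ?(ltW p0)//; field; rewrite gt_eqF.
apply: (moment_le_local indep X0 alpha1 Xfin p1 l0).
- move=> i; apply: (@le_trans _ _ (N^-1 / 2 * N)).
    by rewrite ler_wpM2l ?(ltW l0)//; exact: weighted_normy_ge.
  by rewrite mulrAC mulVf ?gt_eqF// mul1r.
- rewrite -/S; have : sS <= sp * N.
    have := ler_wpM2l (ltW sp0) rho.
    by rewrite spN mulrA ler_pdivlMr// mul1r.
  move=> h; have h2 : S <= p * N ^+ 2.
    rewrite -sS2 -sp2 -exprMn ler_sqr ?nnegrE//; first exact: ltW.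
    by apply: mulr_ge0; exact: ltW.
  have h3 : S / N ^+ 2 <= p by rewrite ler_pdivrMr ?exprn_gt0.
  have -> : (N^-1 / 2) ^+ 2 * S = S / N ^+ 2 / 4 by field; rewrite gt_eqF.
  by move: (p0); lra.
Qed.

End infinite_beta.
End optimize.

(** * The moment inequality *)

Lemma powR_mul_le (R : realType) (k A p u x : R) :
  0 <= k <= A -> 1 <= p -> 0 <= x ->
  (k * (p `^ u * x)) `^ p <= A `^ p * p `^ (p * u) * x `^ p.
Proof.
move=> /andP[k0 kA] p1 x0; have p0 : 0 <= p by exact: le_trans p1.
rewrite powRM ?mulr_ge0 ?powR_ge0// powRM ?powR_ge0// -powRrM (mulrC u) mulrA.
rewrite !ler_wpM2r ?powR_ge0// ge0_ler_powR ?nnegrE//.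
exact: le_trans kA.
Qed.

Lemma conjugate_ereal_cases (R : realType) (alpha : R) (beta : \bar R) :
  1 <= alpha -> ((alpha%:E)^-1 + beta^-1 = 1)%E ->
  (exists b : R, [/\ beta = b%:E, 0 < b & alpha^-1 + b^-1 = 1]) \/
  (beta = +oo%E /\ alpha = 1).
Proof.
move=> a1; have a0 : 0 < alpha by exact: lt_le_trans a1.
have ai : alpha^-1 <= 1 by rewrite invf_le1.
rewrite inver gt_eqF//; case: beta => [b| |].
- rewrite inver; case: eqP => [_|/eqP b0]; first by [].
  move=> [ab]; left; exists b; split => //.
  by rewrite -invr_gt0 lt_neqAle eq_sym invr_eq0 b0/=; lra.
- rewrite invey adde0 => -[ab]; right; split => //.
  by rewrite -(invrK alpha) ab invr1.
- by rewrite inveNy.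
Qed.

Theorem theorem2 (R : realType) :
  exists C C1 C2 : R,
    [/\ 0 < C, 0 < C1, 0 < C2 &
    forall (d : measure_display) (T : measurableType d) (P : probability T R)
      (n : nat) (X : 'I_n -> {RV P >-> R}) (alpha : R) (beta : \bar R)
      (a : 'I_n -> R) (p : R),
    mutually_independent X ->
    (forall i, ('E_P[X i] = 0)%E) ->
    1 <= alpha ->
    (forall i, (orlicz_norm P alpha (X i) < +oo)%E) ->
    ((alpha%:E)^-1 + beta^-1 = 1)%E ->
    1 <= p ->
    let psi i := fine (orlicz_norm P alpha (X i)) in
    let S := \sum_(i < n) a i ^+ 2 * psi i ^+ 2 in
    let N := weighted_norm beta a psi in
    ('E_P[fun w => (`|\sum_(i < n) a i * X i w| `^ p)%R] <=
      (C1 `^ p * p `^ (p / 2) * S `^ (p / 2) +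
       C1 `^ p * p `^ (p / alpha) * N `^ p *
         expR (- (C * (N / S `^ 2^-1) `^ (2 * alpha / (alpha - 2)))))%:E)%E
    /\
    (2 <= alpha ->
     ('E_P[fun w => (`|\sum_(i < n) a i * X i w| `^ p)%R] <=
       (C2 `^ p * Num.min (p `^ (p / 2) * S `^ (p / 2))
                          (p `^ (p / alpha) * N `^ p))%:E)%E)].
Proof.
pose D : R := 4 * expR (2 * mgf_const).
have D0 : 0 < D by rewrite mulr_gt0 ?expR_gt0.
(* D is the constant of moment_le_local and its variants, 2 the loss at
   alpha = 1, and expR 1 pays for the factor exp(-T) when p > T. *)
pose A : R := D * 2 * expR 1.
have e1 : 1 <= expR 1 :> R by have := expR_ge1Dx (1 : R); lra.
have A0 : 0 < A by rewrite !mulr_gt0 ?expR_gt0.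
have D2A : 0 <= D * 2 <= A.
  by rewrite /A ler_peMr// mulr_ge0 ?ltW.
have DA : 0 <= D <= A by move: D2A; lra.
exists 1, A, A; split => // d T P n X alpha beta a p indep X0 alpha1 Xfin ab p1.
move=> psi S N; set M := ('E_P[_])%E.
have p0 : 0 < p by exact: lt_le_trans p1.
have N0 : 0 <= N.
  rewrite /N; have [[b [-> _ _]]|[-> _]] := conjugate_ereal_cases alpha1 ab.
    exact: powR_ge0.
  exact: bigmax_ge_id.
have [Seq0|Sneq0] := eqVneq S 0.
  have M0 : (M <= 0)%E by exact: moment_degenerate Seq0.
  split=> [|_]; apply: le_trans M0 _; rewrite lee_fin.
    by rewrite addr_ge0// !mulr_ge0 ?powR_ge0 ?expR_ge0.
  by rewrite mulr_ge0 ?powR_ge0// le_min !mulr_ge0 ?powR_ge0.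
have S0 : 0 < S.
  rewrite lt_neqAle eq_sym Sneq0 sumr_ge0// => i _.
  by rewrite mulr_ge0 ?sqr_ge0.
have SE : S `^ (p / 2) = (S `^ 2^-1) `^ p by rewrite -powRrM mulrC.
have second : 2 <= alpha -> (M <= (A `^ p *
    Num.min (p `^ (p / 2) * S `^ (p / 2)) (p `^ (p / alpha) * N `^ p))%:E)%E.
  move=> alpha2; rewrite /N.
  have [[b [-> b0 ab']]|[_ alphaE]] := conjugate_ereal_cases alpha1 ab;
    last by exfalso; lra.
  rewrite /Num.min; case: ifP => _.
    rewrite SE mulrA.
    apply: le_trans (moment_gauss indep X0 alpha1 Xfin p1 S0 b0 ab' alpha2) _.
    by rewrite lee_fin powR_mul_le// powR_ge0.
  rewrite mulrA.
  apply: le_trans (moment_powR indep X0 alpha1 Xfin p1 S0 b0 ab' alpha2) _.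
  by rewrite lee_fin powR_mul_le// powR_ge0.
split => //; have [alpha2|alpha2] := leP 2 alpha.
  apply: le_trans (second alpha2) _; rewrite lee_fin.
  rewrite ler_wpDr ?mulr_ge0 ?powR_ge0 ?expR_ge0// -mulrA.
  by rewrite ler_wpM2l ?powR_ge0// ge_min lexx.
rewrite mul1r SE; set rho := N / S `^ 2^-1; set g := 2 * alpha / (alpha - 2).
have a20 : alpha - 2 < 0 by lra.
have a0 : 0 < alpha by lra.
have gV : g^-1 = 2^-1 - alpha^-1.
  by rewrite /g; field; rewrite gt_eqF//= lt_eqF.
have g0 : g < 0 by rewrite -invr_lt0 gV subr_lt0 ltf_pV2 ?posrE.
have [small large] : (rho <= p `^ g^-1 -> exists2 k, 0 <= k <= D * 2 &
      (M <= ((k * (p `^ 2^-1 * S `^ 2^-1)) `^ p)%:E)%E) /\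
    (p `^ g^-1 <= rho -> exists2 k, 0 <= k <= D * 2 &
      (M <= ((k * (p `^ alpha^-1 * N)) `^ p)%:E)%E).
  rewrite gV /rho /N.
  have [[b [-> b0 ab']]|[-> alphaE]] := conjugate_ereal_cases alpha1 ab.
    have DD : 0 <= D <= D * 2 by move: D0; lra.
    split => rhop; exists D => //.
      exact: (moment_gauss_below_threshold indep X0 alpha1 Xfin p1 S0 b0 ab').
    exact: (moment_powR_above_threshold indep X0 alpha1 Xfin p1 S0 b0 ab').
  split => rhop; exists (D * 2); rewrite ?lexx ?andbT ?(mulr_ge0 (ltW D0))//.
    rewrite -[D * 2 * _]mulrA.
    exact: (moment_gauss_below_threshold1 indep X0 alpha1 Xfin p1 S0 alphaE).
  rewrite -[D * 2 * _]mulrA.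
  exact: (moment_powR_above_threshold1 indep X0 alpha1 Xfin p1 S0 alphaE).
have rho0 : 0 < rho.
  rewrite divr_gt0 ?powR_gt0// /N.
  have [[b [-> b0 ab']]|[-> alphaE]] := conjugate_ereal_cases alpha1 ab.
    by apply: weighted_norm_gt0 => //; rewrite gt_eqF.
  have [i bi] := exists_summand_neq0 Sneq0.
  by apply: lt_le_trans bi _; exact: weighted_normy_ge.
have [inv_small inv_large] := powR_le_of_le_powR p0 rho0 g0.
have [prho|rhop] := leP p (rho `^ g).
  have [k /andP[k0 kD] Mk] := small (inv_small prho).
  apply: le_trans Mk _; rewrite lee_fin.
  rewrite ler_wpDr ?mulr_ge0 ?powR_ge0 ?expR_ge0//.
  by rewrite powR_mul_le ?powR_ge0// k0 (le_trans kD)//; move: D2A => /andP[].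
have [k /andP[k0 kD] Mk] := large (inv_large (ltW rhop)).
apply: le_trans Mk _; rewrite lee_fin.
rewrite ler_wpDl ?mulr_ge0 ?powR_ge0//.
apply: (@le_trans _ _ ((D * 2) `^ p * p `^ (p * alpha^-1) * N `^ p)).
  by rewrite powR_mul_le// k0.
have -> : A `^ p = (D * 2) `^ p * expR p.
  rewrite /A (powRM _ (mulr_ge0 (ltW D0) (ler0n _ 2)) (expR_ge0 _)).
  by rewrite -expRM mul1r.
rewrite (_ : _ * expR (- _) = (D * 2) `^ p * p `^ (p / alpha) * N `^ p *
  (expR p * expR (- rho `^ g))); last by ring.
rewrite -expRD ler_peMr ?mulr_ge0 ?powR_ge0//.
by have := expR_ge1Dx (p - rho `^ g); lra.
Qed.
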